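(* For all $k\ge 1$ and all integers $n_1,\dots,n_k\ge 0$, $$\mathcal{L}_q\bigl(L_{n_1}(x;q)\cdots L_{n_k}(x;q)\bigr)=\sum_{\sigma\in\mathcal{D}(n_1,\dots,n_k)}y^{\mathrm{wex}(\sigma)}q^{\mathrm{cr}(\sigma)}.$$
   Context: Notation: $[n]_q=\frac{1-q^n}{1-q}$. The Al-Salam-Chihara polynomials $Q_n(x;\alpha,\beta|q)$ are defined by $Q_{-1}=0$, $Q_0=1$, $Q_{n+1}(x)=(2x-(\alpha+\beta)q^n)Q_n(x)-(1-q^n)(1-\alpha\beta q^{n-1})Q_{n-1}(x)$. The $q$-Laguerre polynomials (depending on a parameter $y$) are $$L_n(x;q)=\left(\frac{\sqrt y}{q-1}\right)^nQ_n\left(\frac{(q-1)x+y+1}{2\sqrt y};\frac1{\sqrt y},\sqrt y\,q\,\Big|\,q\right),$$ and they satisfy $L_{-1}(x;q)=0$, $L_0(x;q)=1$, $L_{n+1}(x;q)=(x-y[n+1]_q-[n]_q)L_n(x;q)-y[n]_q^2L_{n-1}(x;q)$. $S_n$ is the set of permutations of $[n]=\{1,\dots,n\}$. For $\sigma\in S_n$, $\mathrm{wex}(\sigma)=\#\{i: 1\le i\le n,\ i\le\sigma(i)\}$ (weak excedances) and $$\mathrm{cr}(\sigma)=\sum_{i=1}^n\#\{j: j<i\le\sigma(j)<\sigma(i)\}+\sum_{i=1}^n\#\{j: j>i>\sigma(j)>\sigma(i)\}$$ (crossings). $\mathcal{L}_q$ is the linear functional on polynomials in $x$ with $\mathcal{L}_q(x^n)=\sum_{\sigma\in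 S_n}y^{\mathrm{wex}(\sigma)}q^{\mathrm{cr}(\sigma)}$ for all $n\ge 0$ (so $\mathcal{L}_q(1)=1$). Given $n_1,\dots,n_k$ with $n=n_1+\cdots+n_k$, let $S_i$ (for $1\le i\le k$) be the segment of consecutive integers $\{n_1+\cdots+n_{i-1}+1,\dots,n_1+\cdots+n_i\}$, so that $[n]=S_1\cup\cdots\cup S_k$. $\mathcal{D}(n_1,\dots,n_k)$ is the set of permutations $\sigma$ of $[n]$ (generalized derangements) such that for every $i\in[n]$, $i$ and $\sigma(i)$ do not belong to the same segment $S_j$. *)

(* Defs.v *)
From HB Require Import structures.
Set Warnings "-notation-overridden,-ambiguous-paths".
From mathcomp Require Import all_boot all_order all_fingroup all_algebra.
From mathcomp Require Import ring.

Set Implicit Arguments.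
Unset Strict Implicit.
Unset Printing Implicit Defensive.

Import GRing.Theory.
Local Open Scope ring_scope.

Section Permutations.

Variable n : nat.
Implicit Types s : 'S_n.

(* Permutations of {0, ..., n-1} instead of {1, ..., n}: the statistics only
   compare positions and values, so they are unaffected by the shift. *)
Definition wex s : nat := #|[set i : 'I_n | (i <= s i)%N]|.

Definition cr s : nat :=
  (\sum_(i < n) #|[set j : 'I_n | [&& j < i, i <= s j & s j < s i] ]|
   + \sum_(i < n) #|[set j : 'I_n | [&& j > i, i > s j & s j > s i] ]|)%N.

End Permutations.

Section Derangements.

Variables (k : nat) (n : 'I_k -> nat).

Definition segment (j : 'I_k) : {set 'I_(\sum_(i < k) n i)} :=
  [set v : 'I_(\sum_(i < k) n i) |
    (\sum_(i < k | (i < j)%N) n i <= v < \sum_(i < k | (i <= j)%N) n i)%N].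

Definition gen_derangements : {set 'S_(\sum_(i < k) n i)} :=
  [set s : 'S_(\sum_(i < k) n i) |
    [forall v, ~~ [exists j : 'I_k, (v \in segment j) && (s v \in segment j)]]].

End Derangements.

(* The case n = 1 is the three-term recurrence with Q_{-1} = 0. *)
Fixpoint al_salam_chihara (R : comNzRingType) (a b q : R) (n : nat) : {poly R} :=
  match n with
  | 0 => 1
  | 1 => 2%:R *: 'X - (a + b)%:P
  | (m.+1 as m1).+1 =>
      (2%:R *: 'X - ((a + b) * q ^+ m1)%:P) * al_salam_chihara a b q m1
      - ((1 - q ^+ m1) * (1 - a * b * q ^+ m)) *: al_salam_chihara a b q m
  end.

(* [t] is the square root of the parameter y, that is, y = t ^+ 2; both choices
   of the square root give the same polynomial. *)
Definition q_laguerre (F : fieldType) (t q : F) (n : nat) : {poly F} :=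
  (t / (q - 1)) ^+ n *:
    (al_salam_chihara t^-1 (t * q) q n
       \Po ((2%:R * t)^-1 *: ((q - 1) *: 'X + (t ^+ 2 + 1)%:P))).

Definition q_nat (F : fieldType) (q : F) (n : nat) : F :=
  (1 - q ^+ n) / (1 - q).

Section QLaguerreRecurrence.

Variables (F : fieldType) (t q : F).
Hypotheses (two_neq0 : 2%:R != 0 :> F) (t_neq0 : t != 0) (q_neq1 : q != 1).

Let q1_neq0 : q - 1 != 0. Proof. by rewrite subr_eq0. Qed.
Let q1'_neq0 : 1 - q != 0. Proof. by rewrite subr_eq0 eq_sym. Qed.

Let scaled_factor (d e : F) : t ^+ 2 + 1 - t * d = (1 - q) * e ->
  (t / (q - 1)) *: ((2%:R *: 'X - d%:P)
     \Po ((2%:R * t)^-1 *: ((q - 1) *: 'X + (t ^+ 2 + 1)%:P)))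
  = 'X - e%:P.
Proof.
move=> def_e; have -> : e = (t ^+ 2 + 1 - t * d) / (1 - q).
  by rewrite def_e mulrAC divff ?mul1r.
rewrite comp_polyB comp_polyZ comp_polyX comp_polyC.
apply/polyP => i; rewrite !(coefZ, coefD, coefB, coefN, coefC, coefX).
by case: i => [|[|i]] /=; field; rewrite ?two_neq0 ?t_neq0 ?q1_neq0 ?q1'_neq0.
Qed.

Lemma q_laguerre0 : q_laguerre t q 0 = 1.
Proof. by rewrite /q_laguerre expr0 scale1r /= comp_polyC. Qed.

Lemma q_laguerre1 : q_laguerre t q 1 = 'X - (t ^+ 2 * q_nat q 1)%:P.
Proof.
rewrite /q_laguerre expr1 /=; apply: scaled_factor.
by rewrite /q_nat; field; rewrite t_neq0 q1'_neq0.
Qed.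

Lemma q_laguerreSS n :
  q_laguerre t q n.+2 =
    ('X - (t ^+ 2 * q_nat q n.+2 + q_nat q n.+1)%:P) * q_laguerre t q n.+1
    - (t ^+ 2 * q_nat q n.+1 ^+ 2) *: q_laguerre t q n.
Proof.
rewrite -(@scaled_factor ((t^-1 + t * q) * q ^+ n.+1)); last first.
  by rewrite /q_nat !exprS; field; rewrite t_neq0 q1'_neq0.
rewrite /q_laguerre.
rewrite [al_salam_chihara _ _ _ n.+2]/=.
rewrite -/(al_salam_chihara t^-1 (t * q) q n.+1).
rewrite comp_polyB comp_polyM comp_polyZ scalerBr -scalerAl -scalerAr !scalerA.
congr (_ *: _ - _ *: _); rewrite ?exprS //.
by rewrite /q_nat !exprS; field; rewrite t_neq0 q1_neq0 q1'_neq0.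
Qed.

End QLaguerreRecurrence.

Section MomentFunctional.

Variables (R : comNzRingType) (y q : R).

Definition perm_moment (n : nat) : R :=
  \sum_(s : 'S_n) y ^+ wex s * q ^+ cr s.

Definition moment_functional (p : {poly R}) : R :=
  \sum_(i < size p) p`_i * perm_moment i.

Lemma moment_functional_widen (m : nat) (p : {poly R}) :
  (size p <= m)%N -> moment_functional p = \sum_(i < m) p`_i * perm_moment i.
Proof.
move=> le_pm; rewrite /moment_functional (big_ord_widen _ (fun i => p`_i * _ i) le_pm).
rewrite big_mkcond; apply: eq_bigr => i _.
by case: ltnP => // le_pi; rewrite nth_default ?mul0r.
Qed.

Lemma moment_functional_is_scalar : scalar moment_functional.
Proof.
move=> a p r; pose m := maxn (size (a *: p + r)) (maxn (size p) (size r)).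
rewrite !(@moment_functional_widen m) ?leq_max ?leqnn ?orbT //.
rewrite mulr_sumr -big_split; apply: eq_bigr => i _ /=.
by rewrite coefD coefZ mulrDl mulrA.
Qed.

HB.instance Definition _ :=
  GRing.isLinear.Build R {poly R} R *%R moment_functional
    moment_functional_is_scalar.

Lemma moment_functionalXn n : moment_functional 'X^n = perm_moment n.
Proof.
rewrite /moment_functional size_polyXn big_ord_recr /= coefXn eqxx mul1r.
rewrite big1 ?add0r // => i _.
by rewrite coefXn ltn_eqF ?mul0r.
Qed.

End MomentFunctional.

(* Main.v *)
Require Import Defs.
From mathcomp Require Import all_boot all_order all_fingroup all_algebra.
From mathcomp Require Import zify ring.

(* Let W(w) be the generating function of the permutations of the positions of
   a word w, some letters of which are coloured, that send no position to one
   of the same colour. Conjugation by the cycle (0 1 ... N) preserves wex and cr,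
   so W is invariant under rotation of words. If x is an uncoloured letter and
   the colour c does not occur in w, deleting the arc that leaves the first
   position when it ends there or in the block c^n, and deleting the arc that
   enters the first position when it comes from the block c^n, gives
     W(x c^n w) = W(c^(n+1) w) + (y[n+1] + [n]) W(c^n w) + y[n]^2 W(c^(n-1) w),
   which is the three-term recurrence of the q-Laguerre polynomials. Rotating a
   block to the front, one expands a product of q-Laguerre polynomials into
   moments block by block. *)

Set Implicit Arguments.
Unset Strict Implicit.
Unset Printing Implicit Defensive.
Import GRing.Theory.

(** * Crossings and rotations *)

Definition crossing (i j u v : nat) : bool :=
  (j < i <= v) && (v < u) || (u < v < i) && (i < j).

Lemma crE n (s : 'S_n) :
  cr s = \sum_(i < n) \sum_(j < n) crossing i j (s i) (s j).
Proof.
rewrite /cr -big_split; apply: eq_bigr => i _ /=.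
rewrite -!sum1dep_card !(big_mkcond (fun j => _ && _)) -big_split /=.
apply: eq_bigr => j _; rewrite /crossing !andbA; do 2!case: ifP => //=; lia.
Qed.

Lemma wexE n (s : 'S_n) : wex s = \sum_(i < n) (i <= s i).
Proof. by rewrite /wex -sum1dep_card big_mkcond. Qed.

Lemma sum_ltn_ord N a : a <= N -> \sum_(k < N) (k < a) = a.
Proof.
move=> le_aN; rewrite -[RHS]card_ord -sum1_card (big_ord_widen N (fun=> 1)) //.
by rewrite [RHS]big_mkcond.
Qed.

Lemma sum_pred1_mul N (a : 'I_N) c : \sum_(i < N) (i == a) * c = c.
Proof.
rewrite (bigD1 a) //= eqxx mul1n big1 ?addn0 // => i /negbTE -> //.
Qed.

(** As [s] is a bijection, as many values as positions lie below [t]; the arcs with both ends below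
    [t] cancel. *)
Lemma sum_cross_cut n (s : 'S_n) (t : nat) :
  \sum_(i < n) (i < t <= s i) = \sum_(i < n) (s i < t <= i).
Proof.
have : \sum_(i < n) (s i < t) = \sum_(i < n) (i < t).
  by rewrite [RHS](reindex_inj (@perm_inj _ s)).
have E1 : \sum_(i < n) (i < t <= s i) + \sum_(i < n) ((i < t) && (s i < t))
       = \sum_(i < n) (i < t).
  by rewrite -big_split; apply: eq_bigr => i _ /=; lia.
have E2 : \sum_(i < n) (s i < t <= i) + \sum_(i < n) ((i < t) && (s i < t))
       = \sum_(i < n) (s i < t).
  by rewrite -big_split; apply: eq_bigr => i _ /=; lia.
lia.
Qed.

(* Here u = s i, v = s j, a = s 0 and s b = 0 for a permutation s. The two
   compensating sums over (i, j) agree because each cut is crossed by as many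
   arcs upwards as downwards. *)
Lemma crossing_rot N i j u v a b :
  i <= N -> j <= N -> u <= N -> v <= N ->
  (i == j) = (u == v) -> (i == 0) = (u == a) -> (j == 0) = (v == a) ->
  (i == b) = (u == 0) -> (j == b) = (v == 0) ->
  crossing (if i == 0 then N else i.-1) (if j == 0 then N else j.-1)
   (if u == 0 then N else u.-1) (if v == 0 then N else v.-1)
  + ((j == 0) * ((0 < i <= a) && (a < u)) + (u == 0) * ((0 < v < b) && (b < j)))
  = crossing i j u v
  + ((j == 0) * ((0 < u < a) && (a < i)) + (u == 0) * ((0 < j < b) && (b <= v))).
Proof.
move=> hi hj hu hv E1 E2 E3 E4 E5.
have F2 : i = 0 -> a = u by move=> i0; rewrite i0 eqxx in E2; apply/esym/eqP.
have F3 : j = 0 -> a = v by move=> i0; rewrite i0 eqxx in E3; apply/esym/eqP.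
have F4 : u = 0 -> b = i by move=> i0; rewrite i0 eqxx in E4; apply/esym/eqP.
have F5 : v = 0 -> b = j by move=> i0; rewrite i0 eqxx in E5; apply/esym/eqP.
move: E1 F2 F3 F4 F5 hi hj hu hv; clear.
case: i j u v => [|i] [|j] [|u] [|v] /= E1 F2 F3 F4 F5 hi hj hu hv.
all: try (have {}F2 := F2 erefl; subst a).
all: try (have {}F3 := F3 erefl; try subst a).
all: try (have {}F4 := F4 erefl; subst b).
all: try (have {}F5 := F5 erefl; try subst b).
all: rewrite ?mul0n ?mul1n ?addn0 ?add0n /crossing /= ?ltnS ?ltnn ?andbF ?orbF ?ltn0 ?leqn0.
all: try by [].
all: clear -hi hj hu hv; lia.
Qed.

(** Termwise form of the balance between the compensating sums. Their terms are the arcs crossing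
    the cuts at [a.+1] and at [b], apart from the arcs 0 -> a and b -> 0, which the factors
    [(i == 0)] and [(i == b)] account for. Summed over [i], these corrections give 1 on each side,
    because exactly one of [a < b] and [b <= a] holds. *)
Lemma cut_balance i u a b : 0 < a -> 0 < b ->
  (i == 0) = (u == a) -> (i == b) = (u == 0) ->
  (0 < i <= a) && (a < u) + (0 < u < b) && (b < i)
    + (u < a.+1 <= i) + (i < b <= u) + (i == b) * 1
  = (0 < u < a) && (a < i) + (0 < i < b) && (b <= u)
    + (i < a.+1 <= u) + (u < b <= i) + (i == b) * (a < b) + (i == 0) * (b <= a).
Proof.
move=> a_gt0 b_gt0 ea eb.
have F2 : i = 0 -> u = a by move=> i0; rewrite i0 eqxx in ea; apply/eqP.
have F4 : u = 0 -> i = b by move=> u0; rewrite u0 eqxx in eb; apply/eqP.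
have F3 : u = a -> i = 0 by move=> ua; rewrite ua eqxx in ea; apply/eqP.
have F5 : i = b -> u = 0 by move=> i_b; rewrite i_b eqxx in eb; apply/eqP.
rewrite eb; move: a_gt0 b_gt0 F2 F3 F4 F5; clear.
case: i u => [|i] [|u] /=; rewrite ?mul0n ?mul1n ?addn0; lia.
Qed.

Section Rotation.

Variable N : nat.

Definition rot_ord (i : 'I_N.+1) : 'I_N.+1 :=
  if unlift ord0 i is Some k then widen_ord (leqnSn N) k else ord_max.

Lemma val_rot_ord i : rot_ord i = (if i == 0 :> nat then N else i.-1) :> nat.
Proof. by rewrite /rot_ord; case: unliftP => [k|] ->. Qed.

Lemma rot_ord_inj : injective rot_ord.
Proof.
move=> i j /(congr1 val); rewrite /= !val_rot_ord => E; apply: ord_inj.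
have := ltn_ord i; have := ltn_ord j.
by case: (i : nat) (j : nat) E => [|k] [|l] /=; lia.
Qed.

Definition rot_perm := perm rot_ord_inj.

Lemma rot_conj (s : 'S_N.+1) i : (s ^ rot_perm)%g (rot_ord i) = rot_ord (s i).
Proof. by rewrite -[rot_ord i](permE rot_ord_inj) permJ permE. Qed.

(** Only the arcs at 0 can change status. If 0 is not fixed, the arc leaving 0 stops being a weak
    excedance, since its source becomes [N], and the arc entering 0 becomes one, since its target
    becomes [N]. *)
Lemma wex_rot (s : 'S_N.+1) : wex (s ^ rot_perm)%g = wex s.
Proof.
rewrite !wexE (reindex_inj rot_ord_inj) /=.
pose b := (s^-1)%g ord0.
suff: \sum_(i < N.+1) (rot_ord i <= (s ^ rot_perm)%g (rot_ord i))
      + \sum_(i < N.+1) (i == ord0) * 1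
    = \sum_(i < N.+1) (i <= s i) + \sum_(i < N.+1) (i == b) * 1.
  by rewrite !sum_pred1_mul => /addIn.
rewrite -!big_split; apply: eq_bigr => i _ /=; rewrite rot_conj !val_rot_ord.
have sb : s b = ord0 by rewrite permKV.
have: (i == b) = (s i == 0 :> nat).
  by rewrite -(inj_eq (@perm_inj _ s)) sb.
have -> : (i == ord0) = (i == 0 :> nat) by [].
move->; have := ltn_ord i; have := ltn_ord (s i).
by case: (i : nat) (s i : nat) => [|k] [|l] /=; lia.
Qed.

(** Only pairs that involve the arc 0 -> a or the arc b -> 0 change. By [crossing_rot], the pairs
    lost and gained are counted by the two sides of [H]; these agree by [cut_balance] and
    [sum_cross_cut] at the cuts [a.+1] and [b]. *)
Lemma cr_rot (s : 'S_N.+1) : cr (s ^ rot_perm)%g = cr s.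
Proof.
pose b := (s^-1)%g ord0; pose a := s ord0.
have sb : s b = ord0 by rewrite permKV.
have eb i : (i == b) = (s i == 0 :> nat).
  by rewrite -(inj_eq (@perm_inj _ s)) sb.
have ea (i : 'I_N.+1) : (i == 0 :> nat) = (s i == a :> nat).
  by rewrite -[LHS]/(i == ord0) -(inj_eq (@perm_inj _ s)).
rewrite !crE (reindex_inj rot_ord_inj) /=.
under eq_bigr => i _ do rewrite (reindex_inj rot_ord_inj) /=.
have H : \sum_(i < N.+1) (0 < i <= a) && (a < s i)
  + \sum_(j < N.+1) (0 < s j < b) && (b < j)
  = \sum_(i < N.+1) (0 < s i < a) && (a < i)
  + \sum_(j < N.+1) (0 < j < b) && (b <= s j).
  have [a0|a_gt0] := posnP a.
    have b0 : b = 0 :> nat.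
      by apply/eqP; rewrite ea sb a0.
    by rewrite a0 b0; congr (_ + _); apply: eq_bigr => i _; lia.
  have b_gt0 : 0 < b.
    by have := ea b; rewrite sb /=; lia.
  have E1 := sum_cross_cut s a.+1; have E2 := sum_cross_cut s b.
  suff: \sum_(i < N.+1) (0 < i <= a) && (a < s i)
      + \sum_(j < N.+1) (0 < s j < b) && (b < j)
      + \sum_(i < N.+1) (s i < a.+1 <= i) + \sum_(i < N.+1) (i < b <= s i)
      + \sum_(i < N.+1) (i == b) * 1
    = \sum_(i < N.+1) (0 < s i < a) && (a < i)
    + \sum_(j < N.+1) (0 < j < b) && (b <= s j)
    + \sum_(i < N.+1) (i < a.+1 <= s i) + \sum_(i < N.+1) (s i < b <= i)
    + \sum_(i < N.+1) (i == b) * (a < b) + \sum_(i < N.+1) (i == ord0) * (b <= a).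
    by rewrite !sum_pred1_mul; lia.
  rewrite -!big_split; apply: eq_bigr => i _ /=.
  exact: cut_balance (ea i) (eb i).
suff: \sum_(i < N.+1) \sum_(j < N.+1)
        crossing (rot_ord i) (rot_ord j)
          ((s ^ rot_perm)%g (rot_ord i)) ((s ^ rot_perm)%g (rot_ord j))
      + (\sum_(i < N.+1) (0 < i <= a) && (a < s i)
  + \sum_(j < N.+1) (0 < s j < b) && (b < j))
    = \sum_(i < N.+1) \sum_(j < N.+1) crossing i j (s i) (s j)
   + (\sum_(i < N.+1) (0 < s i < a) && (a < i)
  + \sum_(j < N.+1) (0 < j < b) && (b <= s j)).
  by rewrite H => /addIn.
(* Single sums become double sums supported on [j = 0] or on [i = b], so that the identity can be
   checked pair by pair. *)
have sum0 F : \sum_(i < N.+1) F i = \sum_(i < N.+1) \sum_(j < N.+1) (j == ord0) * F i.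
  by apply: eq_bigr => i _; rewrite sum_pred1_mul.
have sumb F : \sum_(i < N.+1) F i = \sum_(i < N.+1) \sum_(j < N.+1) (i == b) * F j.
  by rewrite exchange_big; apply: eq_bigr => i _; rewrite sum_pred1_mul.
rewrite [X in _ + (X + _) = _]sum0 [X in _ + (_ + X) = _]sumb.
rewrite [X in _ = _ + (X + _)]sum0 [X in _ = _ + (_ + X)]sumb.
rewrite -!big_split /=; apply: eq_bigr => i _.
rewrite -!big_split /=; apply: eq_bigr => j _.
rewrite !rot_conj !val_rot_ord.
rewrite eb; apply: crossing_rot; rewrite -?eb -?ea ?leq_ord //.
by rewrite -[LHS]/(i == j) -(inj_eq (@perm_inj _ s)).
Qed.

End Rotation.

(** * Insertion of an arc at the first position *)

(** Effect on two old arcs of inserting an arc from [b] to 0. All values move up by one but the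
    positions below [b] stay, so a weak inequality between a position and a value may become true.
    This creates a crossing only when the arc leaving 0, whose target is now [d], meets the arc
    starting at [d], with [d < b]. *)
Lemma crossing_bump n b d k l u v : 0 < b <= n ->
  (0 < k < n -> n <= u) -> (0 < l < n -> n <= v) ->
  (k = 0 -> u.+1 = d) -> (l = 0 -> v.+1 = d) ->
  crossing (bump b k) (bump b l) u.+1 v.+1
  = crossing k l u v + (l == 0) * ((k == d) && (d < b)) :> nat.
Proof.
move=> hb hk hl ek el; rewrite /bump.
case: k l hk hl ek el => [|k] [|l] /= hk hl ek el.
all: try (have {}ek := ek erefl).
all: try (have {}el := el erefl).
all: rewrite /crossing.
- lia.
- lia.
- case: leqP => ?; lia.
- rewrite mul0n addn0; congr nat_of_bool.
  have fk : k.+1 < b -> n <= u by move=> h; apply: hk; move: h hb; clear; lia.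
  have fl : l.+1 < b -> n <= v by move=> h; apply: hl; move: h hb; clear; lia.
  have {}hb : b <= n by case/andP: hb.
  clear hk hl ek el d.
  have [hbk|hbk] := leqP b k.+1; have [hbl|hbl] := leqP b l.+1;
  rewrite ?(add1n,add0n) ?ltnS.
  all: lia.
Qed.

Section Insertion.

Variables (N n : nat) (s : 'S_N).

Lemma sum_lift_perm (i0 j0 : 'I_N.+1) (F : nat -> nat -> nat) :
  \sum_(i < N.+1) F i (lift_perm i0 j0 s i)
  = F i0 j0 + \sum_(k < N) F (bump i0 k) (bump j0 (s k)).
Proof.
rewrite (bigD1_ord i0) //= lift_perm_id; congr (_ + _).
by apply: eq_bigr => k _; rewrite lift_perm_lift.
Qed.

Lemma cr_lift_perm (i0 j0 : 'I_N.+1) :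
  cr (lift_perm i0 j0 s)
  = \sum_(l < N) crossing i0 (bump i0 l) j0 (bump j0 (s l))
    + \sum_(k < N) crossing (bump i0 k) i0 (bump j0 (s k)) j0
    + \sum_(k < N) \sum_(l < N)
        crossing (bump i0 k) (bump i0 l) (bump j0 (s k)) (bump j0 (s l)).
Proof.
rewrite crE (@sum_lift_perm _ _ (fun i u =>
  \sum_(j < N.+1) crossing i j u (lift_perm i0 j0 s j))).
under [X in _ + X = _]eq_bigr => k _ do
  rewrite (@sum_lift_perm _ _ (fun j v => crossing (bump i0 k) j (bump j0 (s k)) v)).
rewrite (@sum_lift_perm _ _ (fun j v => crossing i0 j j0 v)) big_split /= addnA.
(* The inserted arc does not cross itself. *)
by rewrite [X in X + _ + _ + _](_ : _ = 0) // /crossing; lia.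
Qed.

Lemma wex_insert_source (a : 'I_N.+1) : a <= n ->
  (forall k : 'I_N, k < n -> n <= s k) ->
  wex (lift_perm ord0 a s) = (wex s).+1.
Proof.
move=> le_an hs; rewrite !wexE (@sum_lift_perm _ _ (fun i u => i <= u)) add1n.
by congr _.+1; apply: eq_bigr => k _; have := hs k; rewrite /bump /=; lia.
Qed.

(** The new arc 0 -> a is crossed exactly by the arcs that start at the [a] next positions: by
    hypothesis they all end beyond [a]. Old arcs keep their crossings. *)
Lemma cr_insert_source (a : 'I_N.+1) : n <= N -> a <= n ->
  (forall k : 'I_N, k < n -> n <= s k) ->
  cr (lift_perm ord0 a s) = cr s + a.
Proof.
move=> le_nN le_an hs; rewrite cr_lift_perm crE addnC; congr (_ + _).
  apply: eq_bigr => k _; apply: eq_bigr => l _.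
  by have := hs k; have := hs l; rewrite /crossing /bump /=; lia.
rewrite big1 ?add0n => [|l _]; last by rewrite /crossing /=; lia.
rewrite -[RHS](@sum_ltn_ord N) ?(leq_trans le_an) //; apply: eq_bigr => k _.
by have := hs k; rewrite /crossing /bump /=; lia.
Qed.

Lemma wex_insert_target (b : 'I_N.+1) : 0 < b <= n ->
  (forall k : 'I_N, 0 < k < n -> n <= s k) ->
  wex (lift_perm b ord0 s) = wex s.
Proof.
move=> le_bn hs; rewrite !wexE (@sum_lift_perm _ _ (fun i u => i <= u)).
rewrite (_ : (b <= ord0) = false) ?add0n; last by rewrite leqNgt; case/andP: le_bn => ->.
by apply: eq_bigr => k _; have := hs k; rewrite /bump /=; lia.
Qed.

(** The arcs ending at one of the [b.-1] lowest values of [s] start at 0 or at a position at least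
    [n]; those of the second kind cross the new arc. If the arc leaving 0 is among them, that is if
    [d < b], the new arc has one crossing fewer, but [crossing_bump] gives one more between old
    arcs. *)
Lemma cr_insert_target (b : 'I_N.+1) : n <= N -> 0 < b <= n ->
  (forall k : 'I_N, 0 < k < n -> n <= s k) ->
  cr (lift_perm b ord0 s) = cr s + b.-1.
Proof.
move=> le_nN le_bn hs.
have N_gt0 : 0 < N by move: le_bn le_nN; lia.
pose o := Ordinal N_gt0; pose d := (s o).+1.
rewrite cr_lift_perm crE [X in _ + X + _]big1 ?addn0; last first.
  by move=> l _; rewrite /crossing /=; lia.
have hl : \sum_(l < N) crossing b (bump b l) (ord0 : 'I_N.+1)
              (bump (ord0 : 'I_N.+1) (s l)) + (d < b) = b.-1.
  rewrite -[RHS](@sum_ltn_ord N); last by move: le_bn le_nN; lia.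
  rewrite [RHS](reindex_inj (@perm_inj _ s)) /= -(sum_pred1_mul o (d < b)).
  rewrite -big_split; apply: eq_bigr => l _ /=.
  have := hs l.
  have : (l == o) = (l == 0 :> nat) by [].
  have : l = 0 :> nat -> (s l).+1 = d.
    by move=> l0; rewrite /d; congr (val (s _)).+1; apply: val_inj.
  move: (l == o) (s l : nat) d (l : nat) (b : nat) le_bn; rewrite /crossing /bump.
  by clear; lia.
suff: \sum_(k < N) \sum_(l < N)
        crossing (bump b k) (bump b l)
          (bump (ord0 : 'I_N.+1) (s k)) (bump (ord0 : 'I_N.+1) (s l))
      = \sum_(k < N) \sum_(l < N) crossing k l (s k) (s l) + (d < b).
  by rewrite -hl => ->; rewrite addnCA.
have ed (l : 'I_N) : l = 0 :> nat -> (s l).+1 = d.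
  by move=> l0; rewrite /d; congr (val (s _)).+1; apply: val_inj.
have -> : nat_of_bool (d < b)
    = \sum_(k < N) \sum_(l < N) (l == o) * ((k == d :> nat) && (d < b)).
  under eq_bigr => k _ do rewrite sum_pred1_mul.
  have [lt_db|le_bd] := ltnP d b; last by rewrite big1 // => k _; rewrite andbF.
  have lt_dN : d < N by move: le_bn lt_db le_nN; clear; lia.
  rewrite -[LHS](sum_pred1_mul (Ordinal lt_dN)); apply: eq_bigr => k _.
  by rewrite andbT muln1.
rewrite -big_split /=; apply: eq_bigr => k _.
rewrite -big_split /=; apply: eq_bigr => l _.
exact: (crossing_bump le_bn (hs k) (hs l) (ed k) (ed l)).
Qed.

End Insertion.

(** * Words and their recurrence *)

Section SumLiftPerm.

Variables (V : nmodType) (N : nat).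
Local Open Scope ring_scope.

Lemma lift_perm_inj (i0 j0 : 'I_N.+1) : injective (lift_perm i0 j0).
Proof.
move=> s s' E; apply/permP=> k; apply: (@lift_inj _ j0).
by rewrite -!(lift_perm_lift i0) E.
Qed.

Lemma lift_perm_surj (i0 : 'I_N.+1) (s : 'S_N.+1) :
  exists s' : 'S_N, s = lift_perm i0 (s i0) s'.
Proof.
pose ulsf k := odflt k (unlift (s i0) (s (lift i0 k))).
have ulsfK k : lift (s i0) (ulsf k) = s (lift i0 k).
  rewrite /ulsf; have := neq_lift i0 k.
  by rewrite -(inj_eq (@perm_inj _ s)) => /unlift_some[] ? ? ->.
have inj_ulsf : injective ulsf.
  by move=> k l E; apply: (@lift_inj _ i0); apply: (@perm_inj _ s); rewrite -!ulsfK E.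
exists (perm inj_ulsf); apply/permP=> k.
case: (unliftP i0 k) => [k'|] ->; first by rewrite lift_perm_lift permE ulsfK.
by rewrite lift_perm_id.
Qed.

Lemma reindex_lift_perm (i0 j0 : 'I_N.+1) (P : pred 'S_N.+1) (F : 'S_N.+1 -> V) :
  \sum_(s | P s && (s i0 == j0)) F s
  = \sum_(s : 'S_N | P (lift_perm i0 j0 s)) F (lift_perm i0 j0 s).
Proof.
rewrite -[RHS](big_imset F (h := lift_perm i0 j0)) /=; last first.
  by move=> s s' _ _; apply: lift_perm_inj.
apply: eq_bigl => s; apply/andP/imsetP => [[Ps /eqP <-]|[s' Ps ->]].
  by have [s' Es] := lift_perm_surj i0 s; exists s'; rewrite // unfold_in -Es.
by rewrite lift_perm_id eqxx.
Qed.

Lemma sum_lift_perm_source (i0 : 'I_N.+1) (P : pred 'S_N.+1) (F : 'S_N.+1 -> V) :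
  \sum_(s | P s) F s
  = \sum_(j0 < N.+1) \sum_(s : 'S_N | P (lift_perm i0 j0 s)) F (lift_perm i0 j0 s).
Proof.
rewrite (partition_big (fun s : 'S_N.+1 => s i0) xpredT) //=.
by apply: eq_bigr => j0 _; rewrite reindex_lift_perm.
Qed.

Lemma sum_lift_perm_target (j0 : 'I_N.+1) (P : pred 'S_N.+1) (F : 'S_N.+1 -> V) :
  \sum_(s | P s) F s
  = \sum_(i0 < N.+1) \sum_(s : 'S_N | P (lift_perm i0 j0 s)) F (lift_perm i0 j0 s).
Proof.
rewrite (partition_big (fun s : 'S_N.+1 => (s^-1)%g j0) xpredT) //=.
apply: eq_bigr => i0 _; rewrite -reindex_lift_perm; apply: eq_bigl => s.
by rewrite (can2_eq (permKV s) (permK s)) [j0 == _]eq_sym.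
Qed.

End SumLiftPerm.

Section Words.

Variables (R : comNzRingType) (y q : R) (T : eqType).
Implicit Types (w : seq (option T)) (c d : nat -> option T).

Definition clash (u v : option T) : bool := (u == v) && (u != None).

Definition proper N c (s : 'S_N) : bool := [forall v : 'I_N, ~~ clash (c v) (c (s v))].

Definition weight N (s : 'S_N) : R := (y ^+ wex s * q ^+ cr s)%R.

Definition proper_sum N c : R := (\sum_(s : 'S_N | proper c s) weight s)%R.

Definition word_sum w : R := proper_sum (size w) (nth None w).

Lemma eq_proper_sum N c c' : (forall k, k < N -> c k = c' k) ->
  proper_sum N c = proper_sum N c'.
Proof.
move=> Ec; apply: eq_bigl => s; apply: eq_forallb => v.
by rewrite !Ec ?ltn_ord.
Qed.

(** Conjugation by [rot_perm] matches the permutations proper for the two words and preserves their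
    weight. *)
Lemma word_sum_rcons x w : word_sum (rcons w x) = word_sum (x :: w).
Proof.
rewrite /word_sum size_rcons /=; set N := size w.
rewrite /proper_sum (reindex_inj (conjg_inj (rot_perm N))) /=.
apply: eq_big => [s|s _]; last by rewrite /weight wex_rot cr_rot.
have nth_rot (v : 'I_N.+1) : nth None (rcons w x) (rot_ord v) = nth None (x :: w) v.
  rewrite val_rot_ord nth_rcons; case: v => [[|v] lt_v] /=; first by rewrite ltnn eqxx.
  by move: (lt_v); rewrite ltnS => ->.
apply/forallP/forallP => H v.
  by have := H (rot_ord v); rewrite rot_conj !nth_rot.
by rewrite -[v](permKV (rot_perm N)) permE rot_conj !nth_rot.
Qed.

Lemma word_sum_catC w1 w2 : word_sum (w1 ++ w2) = word_sum (w2 ++ w1).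
Proof.
elim: w1 w2 => [|x w1 IH] w2; first by rewrite cats0.
by rewrite /= -word_sum_rcons rcons_cat IH cat_rcons.
Qed.

Section Recurrence.

Variables (c : T) (d : nat -> option T).
Hypothesis d_fresh : forall k, d k != Some c.

Definition block n k := if k < n then Some c else d (k - n).

Definition free_block n k := if k == 0 then None else block n k.-1.

Let clash_dc k : clash (d k) (Some c) = false.
Proof. by rewrite /clash (negPf (d_fresh k)). Qed.
Let clash_cd k : clash (Some c) (d k) = false.
Proof. by rewrite /clash eq_sym (negPf (d_fresh k)). Qed.
Let clash_cc : clash (Some c) (Some c) = true.
Proof. by rewrite /clash eqxx. Qed.
Let clash_Nx x : clash None x = false.
Proof. exact: andbF. Qed.
Let clash_xN x : clash x None = false.
Proof. by case: x. Qed.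

Lemma proper_block n N (s : 'S_N) : proper (block n) s =
  [forall v : 'I_N, if v < n then n <= s v else
     (n <= s v) ==> ~~ clash (d (v - n)) (d (s v - n))].
Proof.
apply: eq_forallb => v; rewrite /block.
case: (ltnP v n) => _; case: (leqP n (s v)) => _ //=;
  by rewrite ?clash_dc ?clash_cd ?clash_cc.
Qed.

Lemma proper_free_block n N (s : 'S_N) : proper (free_block n) s =
  [forall v : 'I_N, if v <= n then (0 < v) ==> (0 < s v) ==> (n < s v) else
     (n < s v) ==> ~~ clash (d (v - n.+1)) (d (s v - n.+1))].
Proof.
apply: eq_forallb => v; rewrite /free_block /block.
case: (v : nat) => [|v'] /=; first by rewrite clash_Nx.
case: (s v : nat) => [|v''] /=; first by rewrite clash_xN; case: ifP.
rewrite !subSS !ltnS.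
case: (ltnP v' n) => _; case: (leqP n v'') => _ //=;
  by rewrite ?clash_dc ?clash_cd ?clash_cc.
Qed.

Definition avoids n N (s : 'S_N) :=
  [forall v : 'I_N, (0 < v <= n) ==> (0 < s v)].

Definition avoid_sum n m : R :=
  (\sum_(s : 'S_(n + m).+1 | proper (free_block n) s && avoids n s) weight s)%R.

Lemma proper_avoids n N (s : 'S_N) : proper (free_block n) s && avoids n s =
  [forall v : 'I_N, if v <= n then (0 < v) ==> (n < s v) else
     (n < s v) ==> ~~ clash (d (v - n.+1)) (d (s v - n.+1))].
Proof.
rewrite proper_free_block; apply/andP/forallP => [[/forallP H /forallP A] v|H].
  by move: (H v) (A v); case: ifP => //; case: (0 < v) => //= _ /implyP.
split; apply/forallP => v; move: (H v); case: ifP => //=.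
  by case: (0 < v) => //= _ ->; rewrite implybT.
  by case: (0 < v) => //= _; apply: leq_ltn_trans.
by rewrite andbF.
Qed.

(** On the left, positions 1 to [n] may take no value up to [n], and later positions may take any of
    them. Removing the value [a] leaves [n] such values, which act as the block of [block n]. *)
Lemma proper_lift_source n N (a : 'I_N.+1) (s : 'S_N) : a <= n ->
  proper (free_block n) (lift_perm ord0 a s) && avoids n (lift_perm ord0 a s)
  = proper (block n) s.
Proof.
move=> le_an; rewrite proper_avoids proper_block.
apply/forallP/forallP => H v.
  have := H (lift ord0 v); rewrite lift_perm_lift lift0 /= /bump subSS.
  case: ifP => _; first by lia.
  move=> /implyP H'; apply/implyP => le_ns.
  by move: H'; rewrite (leq_trans le_an le_ns) add1n ltnS subSS; apply.
case: (unliftP ord0 v) => [k|] -> //.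
have := H k; rewrite lift_perm_lift lift0 /= /bump subSS.
case: ifP => _; first by lia.
move=> /implyP H'; apply/implyP => lt_ns.
have le_ns : n <= s k by lia.
by rewrite (leq_trans le_an le_ns) add1n subSS; apply: H'.
Qed.

(** Deleting the value 0 and the position [b] leaves [n] block positions but [n.+1] block values,
    now numbered 0 to [n]. The value 0 thus stands for a block letter and is forbidden to the block
    as well, whence [avoids]. *)
Lemma proper_lift_target n N (b : 'I_N.+1) (s : 'S_N) : 0 < b <= n.+1 ->
  proper (free_block n.+1) (lift_perm b ord0 s)
  = proper (free_block n) s && avoids n s.
Proof.
move=> le_bn; rewrite proper_avoids proper_free_block.
apply/forallP/forallP => H v.
  have := H (lift b v); rewrite lift_perm_lift /= /bump /= add1n subSS.
  rewrite (_ : (_ <= n.+1) = (v <= n)); last by lia.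
  case: (leqP v n) => lt_nv; first by lia.
  by rewrite (_ : b <= v) ?add1n ?subSS ?ltnS //; lia.
case: (unliftP b v) => [k|] ->; last by rewrite lift_perm_id !implybT if_same.
move: k; rewrite -[N.+1.-1]/N => k.
have := H k; rewrite lift_perm_lift /= /bump /= add1n subSS.
rewrite (_ : (_ <= n.+1) = (k <= n)); last by lia.
case: (leqP k n) => lt_nv; first by lia.
by rewrite (_ : b <= k) ?add1n ?subSS ?ltnS //; lia.
Qed.

(** If the first position goes to [a <= n], its arc is deleted with factor [y * q ^+ a]. Otherwise
    positions 0 to [n] all go beyond [n], so the first letter acts as one more letter [c]. *)
Lemma avoid_sumE n m :
  (avoid_sum n m = y * (\sum_(a < n.+1) q ^+ a) * proper_sum (n + m) (block n)
    + proper_sum (n + m).+1 (block n.+1))%R.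
Proof.
rewrite /avoid_sum (bigID (fun s : 'S_(n + m).+1 => s ord0 <= n)) /=.
congr (_ + _)%R; last first.
  apply: eq_bigl => s; rewrite proper_avoids proper_block -ltnNge.
  apply/andP/forallP => [[/forallP H lt_n0] v|H].
    move: (H v); rewrite ltnS; case: ifP => // le_vn.
    have [v0 _|//] := posnP v; suff -> : v = ord0 by [].
    exact: ord_inj.
  split; last by have := H ord0.
  apply/forallP => v; move: (H v); rewrite ltnS; case: ifP => // _ ->.
  by rewrite implybT.
rewrite (sum_lift_perm_source ord0).
transitivity (\sum_(a < n.+1) y * q ^+ a * proper_sum (n + m) (block n))%R;
  last by rewrite -mulr_suml -mulr_sumr.
rewrite [RHS](big_ord_widen_cond (n + m).+1 xpredT
  (fun a => y * q ^+ a * proper_sum (n + m) (block n))%R)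
  ?ltnS ?leq_addr // [RHS]big_mkcond /=.
apply: eq_bigr => a _; rewrite ltnS; case: ifP => [le_an|lt_na]; last first.
  by rewrite big_pred0 // => s; rewrite lift_perm_id lt_na andbF.
rewrite mulr_sumr; apply: eq_big => [s|s].
  by rewrite lift_perm_id le_an andbT proper_lift_source.
rewrite lift_perm_id le_an andbT proper_lift_source // => Hs.
have hs (k : 'I_(n + m)) : k < n -> n <= s k.
  by move=> lt_kn; move: Hs; rewrite proper_block => /forallP/(_ k); rewrite lt_kn.
rewrite /weight (wex_insert_source le_an hs) (cr_insert_source (leq_addr m n) le_an hs).
by rewrite exprS exprD; ring.
Qed.

Lemma proper_sum_free0 m : proper_sum m.+1 (free_block 0) = avoid_sum 0 m.
Proof.
apply: eq_bigl => s; rewrite [avoids _ _](_ : _ = true) ?andbT //.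
by apply/forallP => v; case: (v : nat).
Qed.

(** If the block does not avoid the value 0, the arc reaching 0 starts at some position [b.+1] of
    the block, and deleting it yields the factor [q ^+ b]. *)
Lemma proper_sum_freeS n m : (proper_sum (n.+1 + m).+1 (free_block n.+1)
  = avoid_sum n.+1 m + (\sum_(b < n.+1) q ^+ b) * avoid_sum n m)%R.
Proof.
rewrite {1}/proper_sum (bigID (@avoids n.+1 _)) /=; congr (_ + _)%R.
rewrite (sum_lift_perm_target ord0) big_ord_recl /=.
(* When position 0 is fixed, no block position reaches 0, so this term is empty. *)
rewrite [X in (X + _)%R]big_pred0 ?add0r; last first.
  move=> s; suff -> : avoids n.+1 (lift_perm ord0 ord0 s) by rewrite andbF.
  apply/forallP => v.
  apply/implyP => /andP[v_gt0 _].
  case: (unliftP ord0 v) v_gt0 => [k|] -> //.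
  by rewrite lift_perm_lift.
rewrite mulr_suml.
rewrite [RHS](big_ord_widen_cond (n.+1 + m) xpredT
  (fun a => q ^+ a * avoid_sum n m)%R)
  ?leq_addr // [RHS]big_mkcond /=.
apply: eq_bigr => b _; rewrite ltnS.
have avE (s : 'S_(n.+1 + m)) : ~~ avoids n.+1 (lift_perm (lift ord0 b) ord0 s) = (b <= n).
  apply/forallPn/idP => [[v]|le_bn].
    rewrite negb_imply -leqNgt => /andP[/andP[v_gt0 le_vn]].
    case: (unliftP (lift ord0 b) v) v_gt0 le_vn => [k|] -> //.
    by rewrite lift_perm_lift.
  by exists (lift ord0 b); rewrite lift_perm_id negb_imply lift0 ltn0Sn ltnS le_bn.
case: ifP => [le_bn|lt_nb]; last first.
  by rewrite big_pred0 // => s; rewrite avE lt_nb andbF.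
have hb : 0 < lift ord0 b <= n.+1 by rewrite lift0 ltn0Sn ltnS.
rewrite mulr_sumr; apply: eq_big => [s|s].
  by rewrite avE le_bn andbT proper_lift_target.
rewrite avE le_bn andbT proper_lift_target // proper_avoids => /forallP Hs.
have hs (k : 'I_(n.+1 + m)) : 0 < k < n.+1 -> n.+1 <= s k.
  by case/andP=> k0 kn; move: (Hs k); rewrite -ltnS kn k0.
rewrite /weight (wex_insert_target hb hs) (cr_insert_target (leq_addr m n.+1) hb hs).
by rewrite exprD /=; ring.
Qed.

End Recurrence.

Definition gsum n : R := (\sum_(a < n) q ^+ a)%R.

End Words.

(** * Linearization *)

Local Open Scope ring_scope.

Section WordRecurrence.

Variables (F : fieldType) (y q : F) (T : eqType).
Hypothesis q_neq1 : q != 1.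
Implicit Types (c : T) (w : seq (option T)).

Lemma q_natE n : q_nat q n = \sum_(a < n) q ^+ a.
Proof.
have q1 : 1 - q != 0 by rewrite subr_eq0 eq_sym.
rewrite /q_nat -opprB subrX1 -mulNr opprB mulrC mulKf //.
Qed.

Lemma nth_fresh c w k : Some c \notin w -> nth None w k != Some c.
Proof.
move=> cw; have [lt_kw|le_wk] := ltnP k (size w); last by rewrite nth_default.
by apply: contraNneq cw => <-; apply: mem_nth.
Qed.

Lemma nth_block c w n k :
  nth None (nseq n (Some c) ++ w) k = block c (nth None w) n k.
Proof. by rewrite nth_cat size_nseq nth_nseq /block; case: ltnP. Qed.

Lemma word_sum_block c w n : word_sum y q (nseq n (Some c) ++ w)
  = proper_sum y q (n + size w) (block c (nth None w) n).
Proof.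
rewrite /word_sum size_cat size_nseq; apply: eq_proper_sum => k _.
exact: nth_block.
Qed.

Lemma word_sum_free_block c w n : word_sum y q (None :: nseq n (Some c) ++ w)
  = proper_sum y q (n + size w).+1 (free_block c (nth None w) n).
Proof.
rewrite /word_sum /= size_cat size_nseq; apply: eq_proper_sum => -[|k] _ //=.
exact: nth_block.
Qed.

Lemma word_sum1 c w : Some c \notin w ->
  word_sum y q (Some c :: w)
  = word_sum y q (None :: w) - y * q_nat q 1 * word_sum y q w.
Proof.
move=> cw; have fr k := nth_fresh k cw.
rewrite -[None :: w]/(None :: nseq 0 (Some c) ++ w).
rewrite -[Some c :: w]/(nseq 1 (Some c) ++ w) -{3}[w]/(nseq 0 (Some c) ++ w).
rewrite word_sum_free_block !word_sum_block proper_sum_free0 avoid_sumE //.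
by rewrite q_natE [RHS]addrC addKr.
Qed.

Lemma word_sumSS c w n : Some c \notin w ->
  word_sum y q (nseq n.+2 (Some c) ++ w)
  = word_sum y q (None :: nseq n.+1 (Some c) ++ w)
    - (y * q_nat q n.+2 + q_nat q n.+1) * word_sum y q (nseq n.+1 (Some c) ++ w)
    - y * q_nat q n.+1 ^+ 2 * word_sum y q (nseq n (Some c) ++ w).
Proof.
move=> cw; have fr k := nth_fresh k cw.
rewrite word_sum_free_block !word_sum_block proper_sum_freeS // !avoid_sumE //.
by rewrite !q_natE !addSn; ring.
Qed.

Lemma word_sum_nseq_None a : word_sum y q (nseq a (None : option T)) = perm_moment y q a.
Proof.
rewrite /word_sum size_nseq; apply: eq_bigl => s; apply/forallP => v.
by rewrite !nth_nseq !if_same.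
Qed.

End WordRecurrence.

Section Linearization.

Variables (F : fieldType) (q t : F) (T : eqType).
Hypotheses (two_neq0 : 2%:R != 0 :> F) (t_neq0 : t != 0) (q_neq1 : q != 1).
Implicit Types (u : option (T * nat)) (l : seq (option (T * nat))).

(* A factor of a product is either 'X (None) or the q-Laguerre polynomial of
   index m, tagged by the colour of the corresponding segment (Some (c, m)). *)
Definition factor_poly u : {poly F} :=
  if u is Some (_, m) then q_laguerre t q m else 'X.

Definition factor_word u : seq (option T) :=
  if u is Some (c, m) then nseq m (Some c) else [:: None].

Definition word l := flatten (map factor_word l).

Definition colours l := pmap (omap fst) l.

(** Induction measure. The weight [m.+1] rather than [m] makes it decrease also when a factor of
    index 0 is dropped, and 'X weighs 0 so that the recurrence may create it freely. *)
Definition total_size l := sumn [seq if u is Some (_, m) then m.+1 else 0%N | u <- l].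

Lemma total_size_cons u l :
  total_size (u :: l) = ((if u is Some (_, m) then m.+1 else 0) + total_size l)%N.
Proof. by []. Qed.

Lemma word_cat l1 l2 : word (l1 ++ l2) = word l1 ++ word l2.
Proof. by rewrite /word map_cat flatten_cat. Qed.

Lemma word_fresh c l : c \notin colours l -> Some c \notin word l.
Proof.
elim: l => [|[[c' m]|] l IH] //=.
rewrite inE negb_or => /andP[neq_c h]; have cl := IH h.
rewrite -[word _]/(nseq m (Some c') ++ word l) mem_cat negb_or cl andbT.
by rewrite mem_nseq negb_and (_ : (Some c == Some c') = (c == c')) // neq_c orbT.
Qed.

(** Induction on [total_size]: both sides obey the same recurrence in the index of a chosen
    q-Laguerre factor. Without such a factor, both are a moment. Distinct colours make the chosen
    one fresh for the rest of the word. *)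
Lemma moment_functional_factors l : uniq (colours l) ->
  moment_functional (t ^+ 2) q (\prod_(u <- l) factor_poly u)
  = word_sum (t ^+ 2) q (word l).
Proof.
have [N] := ubnP (total_size l); elim: N l => // N IH l.
case: (boolP (has isSome l)) => [|/hasPn allN]; last first.
  have -> : l = nseq (size l) None.
    by apply/all_pred1P/allP => u /allN; case: u.
  move=> _ _; rewrite big_nseq /= -Monoid.iteropE -[iterop _ _ _ _]/('X ^+ _).
  rewrite moment_functionalXn -(word_sum_nseq_None _ _ T); congr word_sum.
  by elim: (size l) => //= a IHa; rewrite {1}IHa.
case/hasP => -[[c m]|] // /splitPr[l1 l2] _.
(* The chosen factor moves to the front, by commutativity of the product on one side and rotation of
   the word on the other. *)
rewrite word_cat big_cat /= mulrC word_sum_catC -word_cat -big_cat /=.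
rewrite /total_size /colours map_cat sumn_cat addnC -sumn_cat -map_cat.
rewrite pmap_cat uniq_catC -pmap_cat /= => lt_N /andP[c_fresh uniq_l].
set l' := l2 ++ l1 in lt_N c_fresh uniq_l *.
have cw := word_fresh c_fresh.
have {}lt_N : (m + total_size l' < N)%N by [].
rewrite big_cons /=.
case: m lt_N => [|[|m]] lt_N.
- by rewrite q_laguerre0 mul1r; apply: IH.
- rewrite q_laguerre1 // mulrBl raddfB /= mul_polyC linearZ /=.
  rewrite -[word _]/(Some c :: word l') word_sum1 // -(IH l') //; last by lia.
  rewrite -[None :: _]/(word (None :: l')) -(IH (None :: l')) //;
    last by rewrite total_size_cons; lia.
  by rewrite big_cons.
rewrite q_laguerreSS // -[word _]/(nseq m.+2 (Some c) ++ word l') word_sumSS //.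
rewrite -[None :: _]/(word [:: None, Some (c, m.+1) & l']).
rewrite -[nseq m.+1 _ ++ _]/(word (Some (c, m.+1) :: l')).
rewrite -[nseq m _ ++ _]/(word (Some (c, m) :: l')).
rewrite -!IH /= ?c_fresh //; try by rewrite ?total_size_cons; lia.
rewrite !big_cons /= mulrBl mulrBl mulrBl !raddfB /=.
rewrite -scalerAl mul_polyC -scalerAl !linearZ /=.
by rewrite mulrA.
Qed.

End Linearization.

(** * Segments as monochromatic blocks of a word *)

Section Segments.

Variables (k : nat) (n : 'I_k -> nat).

(** The enumeration is split at [j]: the blocks before it have total length equal to the lower
    bound, and neither they nor the blocks after it contain the letter [Some j]. *)
Lemma nth_segment_word (j : 'I_k) (v : nat) :
  (nth None (flatten [seq nseq (n i) (Some i) | i <- enum 'I_k]) v == Some j)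
  = (\sum_(i < k | (i < j)%N) n i <= v < \sum_(i < k | (i <= j)%N) n i)%N.
Proof.
have : pairwise (fun i i' : 'I_k => (i < i')%N) (enum 'I_k).
  rewrite -(pairwise_map (fun i : 'I_k => val i) ltn) val_enum_ord.
  by rewrite -sorted_pairwise ?iota_ltn_sorted //; apply: ltn_trans.
have sum_enum (P : pred 'I_k) : \sum_(i < k | P i) n i = \sum_(i <- enum 'I_k | P i) n i.
  by rewrite big_enum_cond /=; apply: eq_bigl.
rewrite !sum_enum.
have /splitPr [e1 e2] : j \in enum 'I_k by rewrite mem_enum.
rewrite pairwise_cat /= => /and3P[].
rewrite allrel_consr => /andP[/allP lt1 _] _ /andP[/allP lt2 _].
rewrite map_cat flatten_cat /= !big_cat /= !big_cons ltnn leqnn.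
(* Stated for a general [P] in order to cover both [i < j] and [i <= j]. *)
have sum1 (P : pred 'I_k) : (forall i : 'I_k, (i < j)%N -> P i) ->
    \sum_(i <- e1 | P i) n i = size (flatten [seq nseq (n i) (Some i) | i <- e1]).
  move=> Pj; rewrite size_flatten sumnE 2!big_map big_seq_cond [RHS]big_seq_cond.
  apply: eq_big => [i|i _]; last by rewrite size_nseq.
  by rewrite andbT; case: (boolP (i \in e1)) => //= /lt1 /Pj.
have sum2 (P : pred 'I_k) : (forall i : 'I_k, (j < i)%N -> ~~ P i) ->
    \sum_(i <- e2 | P i) n i = 0%N.
  move=> Pj; rewrite big_seq_cond big_pred0 // => i.
  by case: (boolP (i \in e2)) => //= /lt2 /Pj /negPf.
rewrite !sum1 ?sum2 // => [|i||]; try by move=> *; lia.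
set A := flatten _; set B := flatten _.
have jA : Some j \notin A.
  apply/flattenP => -[_ /mapP[i /lt1 lt_ij ->]]; rewrite mem_nseq => /andP[_ /eqP[E]].
  by move: lt_ij; rewrite E ltnn.
have jB : Some j \notin B.
  apply/flattenP => -[_ /mapP[i /lt2 lt_ij ->]]; rewrite mem_nseq => /andP[_ /eqP[E]].
  by move: lt_ij; rewrite E ltnn.
rewrite !nth_cat size_nseq nth_nseq.
case: ltnP => [lt_vA|le_Av].
  rewrite (negPf (nth_fresh _ jA)); lia.
case: ltnP => [lt_v|le_v].
  rewrite eqxx; lia.
rewrite (negPf (nth_fresh _ jB)); lia.
Qed.

End Segments.

Theorem theorem5 (F : fieldType) (y q t : F) (two_neq0 : 2%:R != 0 :> F)
    (t_sqrt_y : t ^+ 2 = y) (y_neq0 : y != 0) (q_neq1 : q != 1)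
    (k : nat) (k_gt0 : (0 < k)%N) (n : 'I_k -> nat) :
  moment_functional y q (\prod_(i < k) q_laguerre t q (n i))
  = \sum_(s in gen_derangements n) y ^+ wex s * q ^+ cr s.
Proof.
have t_neq0 : t != 0 by apply: contraNneq y_neq0 => t0; rewrite -t_sqrt_y t0 expr0n.
pose l : seq (option ('I_k * nat)) := [seq Some (i, n i) | i <- enum 'I_k].
have word_l : word l = flatten [seq nseq (n i) (Some i) | i <- enum 'I_k].
  by rewrite /word -map_comp.
have size_l : size (word l) = (\sum_(i < k) n i)%N.
  rewrite word_l size_flatten sumnE 2!big_map big_enum /=.
  by apply: eq_bigr => i _; rewrite size_nseq.
have -> : \prod_(i < k) q_laguerre t q (n i) = \prod_(u <- l) factor_poly q t u.
  by rewrite big_map big_enum.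
rewrite -t_sqrt_y moment_functional_factors //; last first.
  rewrite (_ : colours l = enum 'I_k) ?enum_uniq // /l.
  by elim: (enum _) => //= i e {2}<-.
rewrite /word_sum size_l; apply: eq_bigl => s.
rewrite inE; apply: eq_forallb => v; congr (~~ _).
(* A clash at [v] means that [v] and [s v] carry the same colour [Some j], that is, lie in the same
   segment [j]. *)
apply/idP/existsP => [/andP[/eqP eq_sv]|[j /andP[]]].
  case Ev: (nth None (word l) v) => [j|] // _; exists j.
  by rewrite !inE -!nth_segment_word -!word_l -eq_sv Ev eqxx.
by rewrite !inE -!nth_segment_word -!word_l => /eqP-> /eqP->; rewrite /clash eqxx.
Qed.
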